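(* Let $n\ge 2$, let $\mathscr{C}_H\subseteq\mathbb{F}_2^{2^n-1}$ be the $[2^n-1,\,2^n-1-n,\,3]$ Hamming code, and let $\mathbf{v}_1,\ldots,\mathbf{v}_{|\mathcal{C}_e|}$ be the elements of its subset $\mathcal{C}_e$ of even-weight codewords. Let $A$ be the adjacency matrix of the graph $G_4$ on $\mathcal{C}_e$ in which two elements are adjacent iff their Hamming distance is $4$. For $\mathbf{u}\in\mathbb{F}_2^{2^n-1}$ let $\mathbf{e}_{\mathbf{u}}=[(-1)^{\mathbf{u}\cdot\mathbf{v}_1},\ldots,(-1)^{\mathbf{u}\cdot\mathbf{v}_{|\mathcal{C}_e|}}]^\top$, an eigenvector of $A$ with eigenvalue $\lambda_{\mathbf{u}}=\sum_{\mathbf{s}\in\mathcal{C}_e,\ \mathrm{wt}(\mathbf{s})=4}(-1)^{\mathbf{u}\cdot\mathbf{s}}$; let $\mathcal{Q}=\{\mathbf{e}_{\mathbf{u}}\mid\mathbf{u}\in\mathbb{F}_2^{2^n-1}\}$ and $\lambda_{\min}=\min_{\mathbf{u}}\lambda_{\mathbf{u}}$. Then any eigenvector $\mathbf{e}_{\mathbf{u}}\in\mathcal{Q}$ with $\lambda_{\mathbf{u}}=\lambda_{\min}$, and likewise its negative $-\mathbf{e}_{\mathbf{u}}$, is a valid cut vector $\mathbf{z}\in\{+1,-1\}^{|\mathcal{C}_e|}$ and minimizes $\mathbf{z}^\top A\mathbf{z}$ over $\{+1,-1\}^{|\mathcal{C}_e|}$. Such vectors yield an optimal parity assignment for $\mathcal{C}_e$: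 for $\{\mathbf{p},\bar{\mathbf{p}}\}\in\{P_e,P_o\}$, the assignment giving $\mathbf{v}_i$ the parity $\mathbf{p}$ if $z_i=+1$ and $\bar{\mathbf{p}}$ if $z_i=-1$ is optimal for $\mathcal{C}_e$.
   Context: The $[2^n-1,\,2^n-1-n,\,3]$ Hamming code is the kernel over $\mathbb{F}_2$ of an $n\times(2^n-1)$ matrix whose columns are all the nonzero vectors of $\mathbb{F}_2^n$, each appearing once; every non-codeword is at Hamming distance $1$ from exactly one codeword. $\mathcal{C}_o$ is the set of odd-weight codewords. $\mathbf{u}\cdot\mathbf{v}$ is the $\mathbb{F}_2$ inner product, $\mathrm{wt}$ is Hamming weight, and a bar on a bit vector denotes bitwise complement. Let $P_e=\{00,11\}$ and $P_o=\{01,10\}$, and let $\{P,P'\}=\{P_e,P_o\}$. Given parity assignments $a:\mathcal{C}_e\to P$ and $b:\mathcal{C}_o\to P'$, let $\mathbf{p}_{a,b}:\mathbb{F}_2^{2^n-1}\to\mathbb{F}_2^2$ equal $a$ on $\mathcal{C}_e$, $b$ on $\mathcal{C}_o$, and on a non-codeword equal the bitwise complement of the parity of its unique nearest codeword. Let $\mathrm{Enc}_{a,b}(\mathbf{x})=(\mathbf{x},\mathbf{p}_{a,b}(\mathbf{x}))$ and let $N_2(a,b)$ be the number of unordered pairs of distinct $\mathbf{x},\mathbf{y}\in\mathbb{F}_2^{2^n-1}$ with $d_H(\mathrm{Enc}_{a,b}(\mathbf{x}),\mathrm{Enc}_{a,b}(\mathbf{y}))=2$. A parity assignment $a:\mathcal{C}_e\to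 P$ is optimal for $\mathcal{C}_e$ if $N_2(a,b)\le N_2(a',b)$ for all $a':\mathcal{C}_e\to P$ and all $b:\mathcal{C}_o\to P'$. *)

(* Defs.v *)
From mathcomp Require Import all_boot all_order all_algebra.

Set Implicit Arguments.
Unset Strict Implicit.
Unset Printing Implicit Defensive.

Import Order.TTheory GRing.Theory Num.Theory.
Local Open Scope ring_scope.

Definition wt k (x : 'rV['F_2]_k) : nat := #|[set i | x 0 i != 0]|.

Definition dH k (x y : 'rV['F_2]_k) : nat := #|[set i | x 0 i != y 0 i]|.

Definition dotp k (x y : 'rV['F_2]_k) : 'F_2 := \sum_i x 0 i * y 0 i.

Definition compl k (x : 'rV['F_2]_k) : 'rV['F_2]_k := \row_i (1 - x 0 i).

Definition hamming_matrix n (H : 'M['F_2]_(n, 2 ^ n - 1)) : Prop :=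
  injective (fun j => col j H) /\
  forall w : 'cV['F_2]_n, w != 0 <-> exists j, col j H = w.

Section Hamming.

Variables (n : nat) (H : 'M['F_2]_(n, 2 ^ n - 1)).

Definition hamming_code : {set 'rV['F_2]_(2 ^ n - 1)} :=
  [set x : 'rV['F_2]_(2 ^ n - 1) | H *m x^T == 0].

Definition even_code := [set x in hamming_code | ~~ odd (wt x)].

Definition odd_code := [set x in hamming_code | odd (wt x)].

(* The zero word is a codeword, so the minimum ranges over the whole code. *)
Definition nearest (x : 'rV['F_2]_(2 ^ n - 1)) : 'rV['F_2]_(2 ^ n - 1) :=
  [arg min_(c < 0%R in hamming_code) dH x c]%N.

Definition bits2 (x y : 'F_2) : 'rV['F_2]_2 :=
  \row_j (if j == 0 then x else y).

Definition Pe : {set 'rV['F_2]_2} := [set bits2 0 0; bits2 1 1].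

Definition Po : {set 'rV['F_2]_2} := [set bits2 0 1; bits2 1 0].

(* A map C -> P is a total function on words whose values on C lie in P;
   its values outside C are never used. *)
Definition assignment (C : {set 'rV['F_2]_(2 ^ n - 1)})
    (P : {set 'rV['F_2]_2}) (a : 'rV['F_2]_(2 ^ n - 1) -> 'rV['F_2]_2) : Prop :=
  {in C, forall x, a x \in P}.

Definition code_parity (a b : 'rV['F_2]_(2 ^ n - 1) -> 'rV['F_2]_2)
    (c : 'rV['F_2]_(2 ^ n - 1)) : 'rV['F_2]_2 :=
  if c \in even_code then a c else b c.

Definition parity (a b : 'rV['F_2]_(2 ^ n - 1) -> 'rV['F_2]_2)
    (x : 'rV['F_2]_(2 ^ n - 1)) : 'rV['F_2]_2 :=
  if x \in hamming_code then code_parity a b x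
  else compl (code_parity a b (nearest x)).

Definition Enc (a b : 'rV['F_2]_(2 ^ n - 1) -> 'rV['F_2]_2)
    (x : 'rV['F_2]_(2 ^ n - 1)) : 'rV['F_2]_(2 ^ n - 1 + 2) :=
  row_mx x (parity a b x).

Definition N2 (a b : 'rV['F_2]_(2 ^ n - 1) -> 'rV['F_2]_2) : nat :=
  #|[set [set x; y] | x in [set: 'rV['F_2]_(2 ^ n - 1)],
                        y in [set: 'rV['F_2]_(2 ^ n - 1)]
      & (x != y) && (dH (Enc a b x) (Enc a b y) == 2%N)]|.

Definition optimal_even (P P' : {set 'rV['F_2]_2})
    (a : 'rV['F_2]_(2 ^ n - 1) -> 'rV['F_2]_2) : Prop :=
  assignment even_code P a /\
  forall a' b, assignment even_code P a' -> assignment odd_code P' b ->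
    (N2 a b <= N2 a' b)%N.

Variable R : realFieldType.

(* (-1)^(u . v): the scalar product in 'F_2 is read as the natural number
   0 or 1. *)
Definition chi (u v : 'rV['F_2]_(2 ^ n - 1)) : R := (-1) ^+ (dotp u v : nat).

Definition lambda (u : 'rV['F_2]_(2 ^ n - 1)) : R :=
  \sum_(s in even_code | wt s == 4%N) chi u s.

(* The seed of the iterated minimum is itself one of the values. *)
Definition lambda_min : R := \big[Num.min/lambda 0]_u lambda u.

Definition G4_adj m (v : 'I_m -> 'rV['F_2]_(2 ^ n - 1)) : 'M[R]_m :=
  \matrix_(i, j) (dH (v i) (v j) == 4%N)%:R.

Definition evec m (v : 'I_m -> 'rV['F_2]_(2 ^ n - 1))
    (u : 'rV['F_2]_(2 ^ n - 1)) : 'cV[R]_m :=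
  \col_i chi u (v i).

End Hamming.

Definition eigenvector (R : fieldType) m (A : 'M[R]_m) (l : R) (x : 'cV[R]_m)
    : Prop :=
  x != 0 /\ A *m x = l *: x.

Definition cut_vector (R : realFieldType) m (z : 'cV[R]_m) : Prop :=
  forall i, z i 0 = 1 \/ z i 0 = -1.

Definition qform (R : realFieldType) m (A : 'M[R]_m) (z : 'cV[R]_m) : R :=
  (z^T *m A *m z) 0 0.

(* Main.v *)
(* Counting ordered pairs of encodings at distance 2: two words with nearest
   codewords of opposite parity type contribute independently of the
   assignment, and so do two words with the same nearest codeword. What remains
   are pairs of non-codewords at distance 2 with distinct nearest codewords c,
   d of the same type and equal parities; this forces d_H(c, d) = 4, and each
   such ordered pair (c, d) has exactly 12 pairs of neighbours at distance 2.
   Hence 2 N_2(a, b) = 12 * #{(c, d) in C_e^2 : d_H(c, d) = 4, a c = a d} + (a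
   term depending on b only), and minimizing N_2 over a is minimizing z^T A z
   over cut vectors.

   For the latter, put f(u) = <z, e_u>. Orthogonality of the characters u |->
   (-1)^(u.x) of the full space gives 2^(2^n-1) z^T A z = sum_u lambda_u f(u)^2
   and sum_u f(u)^2 = 2^(2^n-1) |C_e|, so that z^T A z >= lambda_min |C_e|,
   with equality at the eigenvectors e_u for lambda_min. *)
Require Import Defs.
From mathcomp Require Import all_boot all_order all_algebra.
From mathcomp Require Import zify ring.

Import Order.TTheory GRing.Theory Num.Theory.
Local Open Scope ring_scope.

(** * Words over the field with two elements: weight and Hamming distance *)

Lemma F2_cases (x : 'F_2) : x = 0 \/ x = 1.
Proof.
by case: x => -[|[|//]] i; [left | right]; apply: val_inj.
Qed.

Lemma addww {m k} (x : 'M['F_2]_(m, k)) : x + x = 0.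
Proof.
apply/matrixP => i j; rewrite !mxE.
by case: (F2_cases (x i j)) => ->; apply: val_inj.
Qed.

Lemma oppw {m k} (x : 'M['F_2]_(m, k)) : - x = x.
Proof. by apply/eqP; rewrite eq_sym -addr_eq0 addww. Qed.

Section Words.

Context {k : nat}.
Implicit Types x y : 'rV['F_2]_k.

Definition unit_word (i : 'I_k) : 'rV['F_2]_k := delta_mx 0 i.


Lemma addwK x y : x + y + y = x.
Proof. by rewrite -addrA addww addr0. Qed.

Lemma addKw x y : y + (y + x) = x.
Proof. by rewrite addrA addww add0r. Qed.

Lemma addw_eq0 x y : (x + y == 0) = (x == y).
Proof. by rewrite addr_eq0 oppw. Qed.

Lemma dHE x y : dH x y = wt (x + y).
Proof.
apply: eq_card => i; rewrite !inE mxE.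
by case: (F2_cases (x 0 i)) => ->; case: (F2_cases (y 0 i)) => ->.
Qed.

Lemma dHC x y : dH x y = dH y x.
Proof. by rewrite !dHE addrC. Qed.

Lemma wt_eq0 x : (wt x == 0%N) = (x == 0).
Proof.
rewrite cards_eq0; apply/eqP/eqP => [/setP x0 | ->].
  by apply/rowP => i; have := x0 i; rewrite !inE mxE => /negbFE/eqP.
by apply/setP => i; rewrite !inE mxE eqxx.
Qed.

Lemma dH_eq0 x y : (dH x y == 0%N) = (x == y).
Proof. by rewrite dHE wt_eq0 addw_eq0. Qed.

Lemma wtD_le x y : (wt (x + y) <= wt x + wt y)%N.
Proof.
apply: leq_trans (leq_card_setU _ _); apply/subset_leq_card/subsetP => i.
rewrite !inE mxE.
by case: (F2_cases (x 0 i)) => ->; case: (F2_cases (y 0 i)) => ->.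
Qed.

Lemma dH_triangle y x z : (dH x z <= dH x y + dH y z)%N.
Proof.
rewrite !dHE; apply: leq_trans (wtD_le _ _).
by rewrite addrA addwK.
Qed.

Lemma wt_F2 x : (wt x)%:R = \sum_i x 0 i :> 'F_2.
Proof.
rewrite /wt cardE -sum1_size natr_sum big_enum /= big_mkcond.
apply: eq_bigr => i _; rewrite inE.
by case: (F2_cases (x 0 i)) => ->.
Qed.

Lemma odd_F2 m : odd m = (m%:R != 0 :> 'F_2).
Proof.
by rewrite -(dvdn_pcharf (pchar_Fp (isT : prime 2))) dvdn2 negbK.
Qed.

(** Modulo 2 the weight is the sum of the coordinates, which is additive. *)
Lemma odd_wtD x y : odd (wt (x + y)) = odd (wt x) (+) odd (wt y).
Proof.
rewrite !odd_F2 !wt_F2.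
under eq_bigr => i _ do rewrite mxE.
rewrite big_split /=.
by case: (F2_cases (\sum_i x 0 i)) => ->; case: (F2_cases (\sum_i y 0 i)) => ->.
Qed.

Lemma odd_dH x y : odd (dH x y) = odd (wt x) (+) odd (wt y).
Proof. by rewrite dHE odd_wtD. Qed.

Lemma wt_add_unit x i :
  wt (x + unit_word i) = if x 0 i == 0 then (wt x).+1 else (wt x).-1.
Proof.
have same j : j != i -> (x + unit_word i) 0 j = x 0 j.
  by move=> ji; rewrite !mxE eqxx (negPf ji) addr0.
rewrite /wt (cardsD1 i) [in (#|_|).+1](cardsD1 i) [in (#|_|).-1](cardsD1 i).
have -> : [set j | (x + unit_word i) 0 j != 0] :\ i = [set j | x 0 j != 0] :\ i.
  by apply/setP => j; rewrite !inE; case: eqVneq => //= ji; rewrite same.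
rewrite !inE !mxE !eqxx.
by case: (F2_cases (x 0 i)) => ->.
Qed.

Lemma wt_unit i : wt (unit_word i) = 1%N.
Proof.
rewrite -[unit_word i]add0r wt_add_unit mxE eqxx; congr _.+1.
by apply/eqP; rewrite wt_eq0.
Qed.

Lemma unit_word_inj : injective unit_word.
Proof.
move=> i j /rowP/(_ j)/eqP; rewrite !mxE !eqxx /=.
by have [->|] := eqVneq j i.
Qed.

Lemma wt1P x : wt x = 1%N -> exists i, x = unit_word i.
Proof.
move/eqP/cards1P => [i /setP xi]; exists i; apply/rowP => j.
have := xi j; rewrite !inE !mxE eqxx /=.
by case: (F2_cases (x 0 j)) => ->; case: (j == i).
Qed.

Lemma dH1P x y : reflect (exists i, x = y + unit_word i) (dH x y == 1%N).
Proof.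
apply: (iffP eqP) => [|[i ->]].
  by rewrite dHE => /wt1P[i e]; exists i; rewrite -e addrC addwK.
by rewrite dHE addrAC addww add0r wt_unit.
Qed.

(* For [x = c + d] this is the distance between the neighbours
   [c + unit_word i] and [d + unit_word j]. *)
Lemma wt_add_units x i j : (2 < wt x)%N -> ~~ odd (wt x) ->
  (wt (x + (unit_word i + unit_word j)) == 2%N) =
    [&& wt x == 4%N, x 0 i != 0, x 0 j != 0 & i != j].
Proof.
move=> x_gt2 x_even; rewrite addrA !wt_add_unit !mxE eqxx /= (eq_sym j).
have [<- | _] := eqVneq i j; rewrite ?andbF ?addr0.
  (* Flipping the same coordinate twice restores [wt x], which exceeds 2. *)
  by case: (F2_cases (x 0 i)) => -> /=; apply/eqP; lia.
by case: (F2_cases (x 0 i)) => ->; case: (F2_cases (x 0 j)) => -> /=; lia.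
Qed.

(** The two flipped positions must be distinct elements of a support of size 4, in order: 4 * 3 = 12
    choices. *)
Lemma card_wt4_steps x : (2 < wt x)%N -> ~~ odd (wt x) ->
  #|[set ij : 'I_k * 'I_k | wt (x + (unit_word ij.1 + unit_word ij.2)) == 2%N]|
    = (12 * (wt x == 4%N))%N.
Proof.
move=> x_gt2 x_even.
under eq_finset => ij do rewrite wt_add_units //.
case: eqP => [x4 | _]; last by rewrite muln0; apply: eq_card0 => ij; rewrite inE.
rewrite muln1 -sum1_card.
under eq_bigl => ij do rewrite inE /=.
rewrite -(pair_big_dep (fun i : 'I_k => x 0 i != 0)
           (fun i j => (x 0 j != 0) && (i != j)) (fun _ _ => 1%N)) /=.
have -> : 12%N = (wt x * 3)%N by rewrite x4.
rewrite /wt -sum_nat_const; apply: eq_big => [i|i xi]; first by rewrite inE.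
rewrite sum1_card.
have Si : #|[set j | x 0 j != 0] :\ i| = 3.
  by have := x4; rewrite /wt (cardsD1 i) inE xi => -[].
rewrite -[RHS]Si; apply: eq_card => j.
by rewrite !inE unfold_in andbC eq_sym.
Qed.

End Words.

Lemma dHxx {k} (x : 'rV['F_2]_k) : dH x x = 0%N.
Proof. by apply/eqP; rewrite dH_eq0. Qed.

Lemma dH_row_mx {k l} (x x' : 'rV['F_2]_k) (y y' : 'rV['F_2]_l) :
  dH (row_mx x y) (row_mx x' y') = (dH x x' + dH y y')%N.
Proof.
have sumE m (w w' : 'rV['F_2]_m) : dH w w' = (\sum_i nat_of_bool (w ord0 i != w' ord0 i))%N.
  by rewrite /dH cardsE -sum1_card big_mkcond.
rewrite !sumE big_split_ord /=; congr (_ + _)%N; apply: eq_bigr => i _.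
  by rewrite !row_mxEl.
by rewrite !row_mxEr.
Qed.

Lemma wt_le {k} (x : 'rV['F_2]_k) : (wt x <= k)%N.
Proof. by rewrite -[leqRHS]card_ord max_card. Qed.

(** * Complements and the two parity sets *)

Lemma complE {k} (x : 'rV['F_2]_k) : compl x = x + const_mx 1.
Proof. by apply/rowP => i; rewrite !mxE; case: (F2_cases (x 0 i)) => ->; apply: val_inj. Qed.

Lemma dH_compl2 {k} (x y : 'rV['F_2]_k) : dH (compl x) (compl y) = dH x y.
Proof. by rewrite !dHE !complE addrACA addww addr0. Qed.

Lemma dH_compl {k} (x : 'rV['F_2]_k) : dH x (compl x) = k.
Proof.
rewrite dHE complE addKw -[RHS]card_ord; apply: eq_card => i.
by rewrite !inE mxE.
Qed.

Lemma bits2_eq (p : 'rV['F_2]_2) x y :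
  (p == bits2 x y) = (p 0 0 == x) && (p 0 1 == y).
Proof.
apply/eqP/andP => [-> | [/eqP px /eqP py]]; first by rewrite !mxE.
apply/rowP => j; rewrite mxE.
case: j => -[|[|//]] lt_j; rewrite /= -?px -?py; congr (p 0 _); exact: val_inj.
Qed.

Lemma odd_wt2 (p : 'rV['F_2]_2) : odd (wt p) = (p 0 0 != p 0 1).
Proof.
rewrite odd_F2 wt_F2 !big_ord_recl big_ord0 addr0.
have -> : lift ord0 ord0 = 1 :> 'I_2 by apply: val_inj.
by rewrite addr_eq0; case: (F2_cases (p 0 1)) => ->; case: (F2_cases (p 0 0)) => ->.
Qed.

Lemma in_Pe p : (p \in Pe) = ~~ odd (wt p).
Proof.
rewrite !inE !bits2_eq odd_wt2.
by case: (F2_cases (p 0 1)) => ->; case: (F2_cases (p 0 0)) => ->.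
Qed.

Lemma in_Po p : (p \in Po) = odd (wt p).
Proof.
rewrite !inE !bits2_eq odd_wt2.
by case: (F2_cases (p 0 1)) => ->; case: (F2_cases (p 0 0)) => ->.
Qed.

(** A single boolean [t], the weight parity of the members of [P], lets both choices of the pair be
    treated at once. *)
Lemma Pe_Po_pair (P P' : {set 'rV['F_2]_2}) : [set P; P'] = [set Pe; Po] ->
  exists t, (forall p, (p \in P) = (odd (wt p) == t)) /\
            (forall p, (p \in P') = (odd (wt p) == ~~ t)).
Proof.
move=> PP'.
have Pe_neq_Po : Pe != Po.
  by apply/eqP => /setP/(_ 0); rewrite in_Pe in_Po; case: odd.
have : P \in [set Pe; Po] by rewrite -PP' set21.
have : P' \in [set Pe; Po] by rewrite -PP' set22.
have : Po \in [set P; P'] by rewrite PP' set22.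
have : Pe \in [set P; P'] by rewrite PP' set21.
rewrite !inE => Pe1 Po1 /orP[]/eqP P'E /orP[]/eqP PE; subst.
- by move: Po1; rewrite orbb eq_sym (negPf Pe_neq_Po).
- by exists true; split=> p; rewrite ?in_Pe ?in_Po ?eqb_id // eqbF_neg.
- by exists false; split=> p; rewrite ?in_Pe ?in_Po ?eqb_id // eqbF_neg.
- by move: Pe1; rewrite orbb (negPf Pe_neq_Po).
Qed.

(** * The Hamming code: minimum distance and unique nearest codewords *)

Section HammingCode.

Context {n : nat} {H : 'M['F_2]_(n, 2 ^ n - 1)} (HH : hamming_matrix H).
Local Notation word := 'rV['F_2]_(2 ^ n - 1).
Local Notation C := (hamming_code H).
Local Notation Ce := (even_code H).
Implicit Types (x y c d : word).

Lemma in_code x : (x \in C) = (H *m x^T == 0).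
Proof. by rewrite inE. Qed.

Lemma in_even x : (x \in Ce) = (x \in C) && ~~ odd (wt x).
Proof. by rewrite inE. Qed.

Lemma code0 : 0 \in C.
Proof. by rewrite in_code trmx0 mulmx0. Qed.

Lemma even0 : 0 \in Ce.
Proof. by rewrite in_even code0; have /eqP-> : wt (0 : word) == 0%N by rewrite wt_eq0. Qed.

Lemma codeD x y : x \in C -> y \in C -> x + y \in C.
Proof. by rewrite !in_code linearD mulmxDr => /eqP-> /eqP->; rewrite addr0. Qed.

Lemma evenD x y : x \in Ce -> y \in Ce -> x + y \in Ce.
Proof.
rewrite !in_even => /andP[xC xe] /andP[yC ye]; rewrite codeD //=.
by rewrite odd_wtD (negPf xe) (negPf ye).
Qed.

Lemma syndrome_unit j : H *m (unit_word j)^T = col j H.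
Proof. by rewrite trmx_delta colE. Qed.

(** A codeword of weight 1 would make a column of [H] zero, and one of weight 2 would make two
    distinct columns equal. *)
Lemma code_min_wt x : x \in C -> x != 0 -> (2 < wt x)%N.
Proof.
rewrite in_code => /eqP xC; rewrite -wt_eq0.
case E: (wt x) => [|[|[|w]]] // _; exfalso.
  have [i xi] := wt1P x E; move: xC; rewrite xi syndrome_unit.
  by apply/eqP; apply/(proj2 HH); exists i.
have /set0Pn[i] : [set i | x 0 i != 0] != set0 by rewrite -card_gt0 -/(wt x) E.
rewrite inE => xi.
have [j xj] : exists j, x + unit_word i = unit_word j.
  by apply: wt1P; rewrite wt_add_unit (negPf xi) E.
have x0 : x = 0.
  move: xC; rewrite -(addwK x (unit_word i)) xj linearD mulmxDr !syndrome_unit.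
  move/eqP; rewrite addr_eq0 oppw => /eqP/(proj1 HH) ->.
  exact: addww.
by move: xi; rewrite x0 mxE eqxx.
Qed.

Lemma code_min_dist c d : c \in C -> d \in C -> c != d -> (2 < dH c d)%N.
Proof. by move=> cC dC cd; rewrite dHE code_min_wt ?codeD // addw_eq0. Qed.

(** The nonzero syndrome of [x] is some column [j] of [H]; flipping coordinate [j] cancels it. *)
Lemma covering x : x \notin C -> exists2 c, c \in C & dH x c = 1%N.
Proof.
rewrite in_code => /(proj2 HH)[j xj]; exists (x + unit_word j).
  by rewrite in_code linearD mulmxDr syndrome_unit xj addww.
by rewrite dHE addKw wt_unit.
Qed.

Lemma nearestP x : x \notin C -> nearest H x \in C /\ dH x (nearest H x) = 1%N.
Proof.
move=> xC; have [c cC xc] := covering x xC.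
rewrite /nearest; case: arg_minnP => [|d dC dmin]; first exact: code0.
have := dmin c cC; rewrite xc => xd_le; split=> //.
apply/eqP; rewrite eqn_leq xd_le lt0n dH_eq0.
by apply: contraNneq xC => ->.
Qed.

(** Two codewords at distance 1 from [x] are at distance at most 2 from each other, below the
    minimum distance. *)
Lemma nearest_unique x c : x \notin C -> c \in C -> dH x c = 1%N -> nearest H x = c.
Proof.
move=> xC cC xc; have [dC xd] := nearestP x xC.
apply: contraTeq isT => dc; have := code_min_dist _ _ dC cC dc.
by have := dH_triangle x (nearest H x) c; rewrite (dHC _ x) xd xc; lia.
Qed.

Lemma neighbor_notin c i : c \in C -> c + unit_word i \notin C.
Proof.
move=> cC; apply/negP => xC.
have := code_min_wt _ (codeD _ _ cC xC); rewrite addKw wt_unit -wt_eq0 wt_unit.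
by move/(_ isT).
Qed.

Lemma nearest_neighbor c i : c \in C -> nearest H (c + unit_word i) = c.
Proof.
move=> cC; apply: nearest_unique; rewrite ?neighbor_notin //.
by apply/eqP/dH1P; exists i.
Qed.

End HammingCode.

(** * Counting pairs of encodings at distance 2 *)

(** Each unordered pair is the image of exactly two ordered ones, since [e] is irreflexive and
    symmetric. *)
Lemma card_unordered_pairs (T : finType) (e : rel T) :
  symmetric e -> irreflexive e ->
  (#|[set [set x; y] | x in [set: T], y in [set: T] & e x y]| * 2)%N =
    #|[set xy : T * T | e xy.1 xy.2]|.
Proof.
move=> e_sym e_irr; set D := [set xy | _].
pose f (xy : T * T) := [set xy.1; xy.2].
have -> : [set [set x; y] | x in [set: T], y in [set: T] & e x y] = f @: D.
  apply/setP => A; apply/imset2P/imsetP => [[x y _] | [[x y]]].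
    by rewrite !inE /= => xy ->; exists (x, y); rewrite // inE.
  by rewrite inE /= => xy ->; exists x y; rewrite ?inE.
rewrite -[RHS]sum1_card (partition_big_imset f) /= -sum_nat_const.
apply: eq_bigr => A /imsetP[[x y]]; rewrite inE /= => xy ->.
have x_neq_y : x != y by apply: contraTneq xy => ->; rewrite e_irr.
have <- : #|[set (x, y); (y, x)]| = 2%N.
  by rewrite cards2 xpair_eqE (negPf x_neq_y).
rewrite -sum1_card; apply: eq_bigl => -[z w]; rewrite !inE /= /f /= !xpair_eqE.
apply/orP/andP => [[] /andP[/eqP-> /eqP->] | [zw /eqP/setP fE]].
- by rewrite xy.
- by rewrite e_sym xy setUC.
have zw' : z != w by apply: contraTneq zw => ->; rewrite e_irr.
have := fE w; have := fE z; rewrite !inE !eqxx orbT /= => /esym zxy /esym wxy.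
by move: zw'; case/orP: zxy => /eqP->; case/orP: wxy => /eqP->;
  rewrite ?eqxx //=; auto.
Qed.

(** Complementing flips two bits, so a non-codeword gets a parity of the same type as its nearest
    codeword. *)
Lemma odd_wt_compl (p : 'rV['F_2]_2) : odd (wt (compl p)) = odd (wt p).
Proof.
have := odd_dH p (compl p); rewrite dH_compl.
by case: (odd (wt p)); case: (odd (wt (compl p))).
Qed.

Section PairCount.

Context {n : nat} {H : 'M['F_2]_(n, 2 ^ n - 1)} (HH : hamming_matrix H).
Local Notation word := 'rV['F_2]_(2 ^ n - 1).
Local Notation C := (hamming_code H).
Local Notation Ce := (even_code H).
Local Notation near := (nearest H).
Implicit Types (x y c d : word) (a b : word -> 'rV['F_2]_2).

(** The edges of $G_4$ left uncut by the colouring [a], each counted in both orders. *)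
Definition mono_pairs a : {set word * word} :=
  [set cd | [&& cd.1 \in Ce, cd.2 \in Ce, dH cd.1 cd.2 == 4%N & a cd.1 == a cd.2]].

(* [even_part] and [rest_part] partition the pairs of distinct words whose
   encodings are at distance 2; only [even_part] depends on [a]. *)
Definition even_part a x y : bool :=
  [&& x \notin C, y \notin C, near x \in Ce, near y \in Ce, near x != near y,
      dH x y == 2%N & a (near x) == a (near y)].

Definition rest_part b x y : bool :=
  [&& x \notin C, y \notin C &
    if near x == near y then (x != y) && (dH x y == 2%N)
    else if odd (dH (near x) (near y)) then dH x y == 1%N
    else [&& near x \notin Ce, dH x y == 2%N & b (near x) == b (near y)]].

(** Parities of two codewords are at odd distance exactly when the codewords are. Only two
    non-codewords can qualify. With the same nearest codeword their parities agree; with nearest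
    codewords at odd distance the parities differ in one bit; otherwise the parities must be
    equal. *)
Lemma Enc_dist2 a b t :
  {in Ce, forall c, odd (wt (a c)) = t} ->
  {in odd_code H, forall c, odd (wt (b c)) = ~~ t} ->
  forall x y,
  ((x != y) && (dH (Enc H a b x) (Enc H a b y) == 2%N) : nat) =
  (even_part a x y + rest_part b x y)%N.
Proof.
move=> a_odd b_odd x y; rewrite dH_row_mx /even_part /rest_part.
have q_odd c : c \in C -> odd (wt (code_parity H a b c)) = odd (wt c) (+) t.
  rewrite /code_parity => cC; case: ifPn => [cCe | cCe].
    by rewrite a_odd //; move: cCe; rewrite in_even cC /= => /negPf->.
  have cCo : c \in odd_code H by move: cCe; rewrite in_even !inE -in_code cC /= negbK.
  by rewrite b_odd //; move: cCo; rewrite inE => /andP[_ ->].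
have [-> | xy] /= := eqVneq x y.
  rewrite eqxx /=.
  by rewrite /= !andbF.
have qdist c d : c \in C -> d \in C ->
    odd (dH (code_parity H a b c) (code_parity H a b d)) = odd (dH c d).
  move=> cC dC; rewrite !odd_dH !q_odd //.
  by case: t {a_odd b_odd q_odd}; case: (odd (wt c)); case: (odd (wt d)).
(* If [c] is nearest to [z] the total is 1 + 2. Otherwise [dH c z] is at least 2, and if it is 2
   then [c] and [near z] are at distance 3, which is odd, so the parities differ. *)
have far c z : c \in C -> z \notin C ->
    (dH c z + dH (code_parity H a b c) (compl (code_parity H a b (near z))) == 2)%N = false.
  move=> cC zC; have [dC zd] := nearestP HH z zC.
  have [-> | cd] := eqVneq c (near z).
    by rewrite dHC zd dH_compl.
  have := code_min_dist HH _ _ cC dC cd.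
  have := dH_triangle z c (near z); rewrite zd.
  have : odd (dH (code_parity H a b c) (compl (code_parity H a b (near z)))) =
         odd (dH c (near z)).
    by rewrite -qdist // !odd_dH odd_wt_compl.
  by case: eqP => //=; lia.
rewrite /parity.
have [xC | xC] /= := boolP (x \in C); have [yC | yC] /= := boolP (y \in C).
- have := code_min_dist HH _ _ xC yC xy.
  by case: eqP => //=; lia.
- by rewrite far.
- by rewrite dHC [dH (compl _) _]dHC far.
have [cC xc] := nearestP HH x xC; have [dC yd] := nearestP HH y yC.
rewrite dH_compl2.
have [-> | cd] := eqVneq (near x) (near y).
  by rewrite dHxx addn0 !andbF.
rewrite /= -(qdist _ _ cC dC).
have le2 := wt_le (code_parity H a b (near x) + code_parity H a b (near y)).
rewrite -dHE in le2.
have dist0 : (dH x y == 0%N) = false by rewrite dH_eq0 (negPf xy).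
have even_iff : ~~ odd (dH (near x) (near y)) -> (near y \in Ce) = (near x \in Ce).
  by rewrite odd_dH !in_even cC dC /=; case: odd; case: odd.
have not_even : odd (dH (near x) (near y)) -> (near x \in Ce) && (near y \in Ce) = false.
  by rewrite odd_dH !in_even cC dC /=; case: odd; case: odd.
move: (qdist _ _ cC dC) => dqE.
case: ifPn => [odd_q | even_q].
  (* An odd distance between two-bit words is 1, which leaves 1 for [dH x y]. *)
  rewrite dqE in odd_q; have := not_even odd_q.
  move: dqE; rewrite odd_q.
  by case: (near x \in Ce); case: (near y \in Ce) => //= q1 _; lia.
rewrite dqE in even_q; rewrite even_iff //.
(* The parity distance is even and [dH x y] is positive, so a total of 2 forces equal parities. *)
have -> : (dH x y + dH (code_parity H a b (near x)) (code_parity H a b (near y)) == 2)%N =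
   (dH x y == 2%N) && (code_parity H a b (near x) == code_parity H a b (near y)).
  rewrite -[X in _ && X]dH_eq0; move: dist0 even_q; rewrite -dqE; lia.
rewrite /code_parity even_iff //.
by case: (near x \in Ce) => /=; rewrite ?addn0.
Qed.

(** Group the pairs by their nearest codewords [(c, d)]; the fibre consists of the pairs of
    neighbours of [c] and [d] at distance 2, counted by [card_wt4_steps]. *)
Lemma card_even_part a :
  (\sum_(xy : word * word) even_part a xy.1 xy.2 = 12 * #|mono_pairs a|)%N.
Proof.
(* [D] leaves the distance of the two codewords free; the fibre count itself vanishes unless it is
   4. *)
pose D := [set cd : word * word | [&& cd.1 \in Ce, cd.2 \in Ce, cd.1 != cd.2 & a cd.1 == a cd.2]].
pose f (xy : word * word) := (near xy.1, near xy.2).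
rewrite -big_mkcond /= (partition_big f (mem D)) /=; last first.
  move=> [x y]; rewrite /even_part /= => /and5P[_ _ xe ye /and3P[xy _ axy]].
  by rewrite /f inE /= xe ye xy axy.
transitivity (\sum_(cd in D) 12 * (dH cd.1 cd.2 == 4))%N; last first.
  rewrite -big_distrr /= -sum1_card big_mkcond [in RHS]big_mkcond /=.
  congr (_ * _)%N; apply: eq_bigr => -[c d] _ /=.
  rewrite [_ \in D]inE [_ \in mono_pairs a]inE /=.
  case: (c \in Ce) => //; case: (d \in Ce) => //=.
  have [-> | cd] /= := eqVneq c d; first by rewrite dHxx.
  by case: (a c == a d); case: (dH c d == 4%N).
apply: eq_bigr => -[c d]; rewrite inE /= => /and4P[cCe dCe cd acd].
have cC : c \in C by move: cCe; rewrite in_even => /andP[].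
have dC : d \in C by move: dCe; rewrite in_even => /andP[].
have even_cd : ~~ odd (wt (c + d)).
  by move: cCe dCe; rewrite !in_even cC dC odd_wtD /= => /negPf-> /negPf->.
rewrite dHE -card_wt4_steps // -?dHE ?(code_min_dist HH) //.
(* The fibre over [(c, d)] is parametrized by the positions flipped in [c] and in [d]. *)
pose g (ij : 'I_(2 ^ n - 1) * 'I_(2 ^ n - 1)) := (c + unit_word ij.1, d + unit_word ij.2).
have g_inj : injective g.
  by move=> [i j] [i' j'] [/addrI/unit_word_inj-> /addrI/unit_word_inj->].
rewrite -(card_imset _ g_inj) -sum1_card; apply: eq_bigl => -[x y].
rewrite /even_part /f xpair_eqE /=.
apply/andP/imsetP => [[xy /andP[/eqP xc /eqP yd]] | [[i j]]].
  move: xy; rewrite xc yd => /and5P[xC yC _ _ /and3P[_ xy2 _]].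
  have [_ /eqP/dH1P[i xi]] := nearestP HH x xC.
  have [_ /eqP/dH1P[j yj]] := nearestP HH y yC.
  rewrite xc in xi; rewrite yd in yj; exists (i, j); last by rewrite xi yj.
  by rewrite inE /= addrACA -xi -yj -dHE.
rewrite inE /= addrACA -dHE => xy2 [-> ->].
by rewrite !nearest_neighbor // !neighbor_notin // cCe dCe cd acd xy2 !eqxx.
Qed.

Lemma N2E a b t :
  {in Ce, forall c, odd (wt (a c)) = t} ->
  {in odd_code H, forall c, odd (wt (b c)) = ~~ t} ->
  (N2 H a b * 2 = 12 * #|mono_pairs a| +
                  \sum_(xy : word * word) rest_part b xy.1 xy.2)%N.
Proof.
move=> a_odd b_odd.
pose e x y := (x != y) && (dH (Enc H a b x) (Enc H a b y) == 2%N).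
rewrite /N2 (card_unordered_pairs _ e); first last.
- by move=> x; rewrite /e eqxx.
- by move=> x y; rewrite /e eq_sym dHC.
rewrite -card_even_part -big_split /= -sum1_card big_mkcond.
by apply: eq_bigr => xy _;
  rewrite inE -(Enc_dist2 _ _ _ a_odd b_odd) -/(e _ _); case: (e _ _).
Qed.

(** For fixed [b] the [rest_part] sum is common to both sides and cancels, so one comparison of
    uncut edges serves every [b]. *)
Lemma optimal_of_mono_min (P P' : {set 'rV['F_2]_2}) a :
  [set P; P'] = [set Pe; Po] -> assignment Ce P a ->
  (forall a', assignment Ce P a' -> #|mono_pairs a| <= #|mono_pairs a'|)%N ->
  optimal_even H P P' a.
Proof.
move=> /Pe_Po_pair[t [inP inP']] aP a_min; split=> // a' b a'P bP'.
have oddP a0 : assignment Ce P a0 -> {in Ce, forall c, odd (wt (a0 c)) = t}.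
  by move=> a0P c cCe; apply/eqP; rewrite -inP a0P.
have odd_b : {in odd_code H, forall c, odd (wt (b c)) = ~~ t}.
  by move=> c cCo; apply/eqP; rewrite -inP' bP'.
rewrite -(leq_pmul2r (_ : 0 < 2)%N) //.
rewrite !(N2E _ _ t) //; [|exact: oddP..].
by rewrite leq_add2r leq_mul2l a_min ?orbT.
Qed.

End PairCount.

(** * Characters, the spectrum of $G_4$ and its quadratic form *)

Section Spectrum.

Context {R : realFieldType} {n : nat} {H : 'M['F_2]_(n, 2 ^ n - 1)}.
Context {v : 'I_#|even_code H| -> 'rV['F_2]_(2 ^ n - 1)}.
Context (v_inj : injective v)
  (v_onto : [set v i | i : 'I_#|even_code H|] = even_code H).
Local Notation word := 'rV['F_2]_(2 ^ n - 1).
Local Notation Ce := (even_code H).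
Local Notation A := (G4_adj R v).
Local Notation m := #|even_code H|.
Local Notation chi := (chi R).
Implicit Types (u w x y : word) (z : 'cV[R]_m).

Lemma signF2D (a b : 'F_2) :
  (-1) ^+ (a + b)%R = (-1) ^+ a * (-1) ^+ b :> R.
Proof.
by case: (F2_cases a) => ->; case: (F2_cases b) => ->;
  rewrite /= ?expr0 ?expr1 ?mulr1 ?mul1r ?mulrNN ?mulr1.
Qed.

Lemma dotpDr u x y : dotp u (x + y) = dotp u x + dotp u y.
Proof. by rewrite /dotp -big_split; apply: eq_bigr => i _; rewrite mxE mulrDr. Qed.

Lemma dotpDl u w x : dotp (u + w) x = dotp u x + dotp w x.
Proof. by rewrite /dotp -big_split; apply: eq_bigr => i _; rewrite mxE mulrDl. Qed.

Lemma chiDr u x y : chi u (x + y) = chi u x * chi u y.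
Proof. by rewrite /Defs.chi dotpDr signF2D. Qed.

Lemma chiDl u w x : chi (u + w) x = chi u x * chi w x.
Proof. by rewrite /Defs.chi dotpDl signF2D. Qed.

Lemma chi_cases u x : chi u x = 1 \/ chi u x = -1.
Proof.
by rewrite /Defs.chi; case: (F2_cases (dotp u x)) => ->; [left | right]; rewrite ?expr0 ?expr1.
Qed.

Lemma chi_sq u x : chi u x * chi u x = 1.
Proof. by case: (chi_cases u x) => ->; rewrite ?mulrNN mulr1. Qed.

Lemma chi_unit_word i x : x 0 i != 0 -> chi (unit_word i) x = -1.
Proof.
move=> xi; rewrite /Defs.chi.
have -> : dotp (unit_word i) x = x 0 i.
  rewrite /dotp (bigD1 i) //= big1 => [|j ji].
    by rewrite mxE !eqxx mul1r addr0.
  by rewrite mxE eqxx (negPf ji) mul0r.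
by case: (F2_cases (x 0 i)) xi => -> //; rewrite expr1.
Qed.

(** For nonzero [x], translating [u] by a unit word in the support of [x] negates the sum. *)
Lemma sum_chi x : \sum_u chi u x = #|{: word}|%:R * (x == 0)%:R.
Proof.
have [-> | x_neq0] := eqVneq x 0.
  rewrite mulr1 -sum1_card natr_sum; apply: eq_bigr => u _.
  (* Writing 0 as 0 + 0 turns the character value into a square. *)
  by rewrite -[0](addww (0 : word)) chiDr chi_sq.
have [i xi] : exists i, x 0 i != 0 by apply/rV0Pn.
rewrite mulr0; apply/eqP; rewrite -eqNr; apply/eqP.
rewrite [RHS](reindex_inj (addIr (unit_word i))) -sumrN.
by apply: eq_bigr => u _; rewrite chiDl (chi_unit_word _ _ xi) mulrN1.
Qed.

Lemma v_even i : v i \in Ce.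
Proof. by rewrite -[in X in _ \in X]v_onto imset_f. Qed.

Lemma sum_v (V : nmodType) (F : word -> V) : \sum_i F (v i) = \sum_(c in Ce) F c.
Proof. by rewrite -[in RHS]v_onto big_imset //= => i j _ _ /v_inj. Qed.

(** $G_4$ is the Cayley graph of the group $\mathcal{C}_e$ with the codewords of weight 4 as
    connection set; hence characters are eigenvectors. *)
Lemma sum_adj (F : word -> R) i :
  \sum_j A i j * F (v j) = \sum_(s in Ce | wt s == 4%N) F (v i + s).
Proof.
under eq_bigr => j _ do rewrite mxE.
rewrite (sum_v _ (fun c => (dH (v i) c == 4%N)%:R * F c)).
rewrite (reindex_inj (addrI (v i))) /=.
rewrite big_mkcond [RHS]big_mkcond /=; apply: eq_bigr => s _.
have -> : (v i + s \in Ce) = (s \in Ce).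
  by apply/idP/idP => sCe; [rewrite -(addKw s (v i))|]; rewrite evenD ?v_even.
rewrite dHE addKw; case: (s \in Ce) => //=.
by case: eqP; rewrite ?mul1r ?mul0r.
Qed.

Lemma adj_mul_evec u : A *m evec R v u = lambda H R u *: evec R v u.
Proof.
apply/colP => i; rewrite !mxE.
under eq_bigr => j _ do rewrite [evec R v u j _]mxE.
rewrite sum_adj /lambda big_distrl /=; apply: eq_bigr => s _.
by rewrite chiDr mulrC.
Qed.

Lemma evec_eigenvector u : eigenvector A (lambda H R u) (evec R v u).
Proof.
split; last exact: adj_mul_evec.
(* The zero word provides an index, so the vector has an entry, and that entry is 1 or -1. *)
have : 0 \in [set v i | i : 'I_m] by rewrite v_onto even0.
case/imsetP => i _ _; apply/eqP => /colP/(_ i)/eqP; rewrite !mxE.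
by case: (chi_cases u (v i)) => ->; rewrite ?oppr_eq0 oner_eq0.
Qed.

Lemma evec_cut u : cut_vector (evec R v u).
Proof. by move=> i; rewrite mxE; apply: chi_cases. Qed.

Lemma cut_vectorN z : cut_vector z -> cut_vector (- z).
Proof. by move=> zc i; rewrite mxE; case: (zc i) => ->; rewrite ?opprK; [right | left]. Qed.

Lemma cut_vector_sq z i : cut_vector z -> z i 0 * z i 0 = 1.
Proof. by move=> /(_ i)[] ->; rewrite ?mulrNN mulr1. Qed.

Lemma qformE (B : 'M[R]_m) z :
  qform B z = \sum_i \sum_j B i j * (z i 0 * z j 0).
Proof.
rewrite /qform -mulmxA mxE; apply: eq_bigr => i _.
rewrite !mxE big_distrr /=; apply: eq_bigr => j _.
by rewrite mulrCA mulrA.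
Qed.

Lemma qformN (B : 'M[R]_m) z : qform B (- z) = qform B z.
Proof.
by rewrite !qformE; apply: eq_bigr => i _; apply: eq_bigr => j _; rewrite !mxE mulrNN.
Qed.

Lemma qform_evec u : qform A (evec R v u) = lambda H R u * m%:R.
Proof.
rewrite /qform -mulmxA adj_mul_evec -scalemxAr mxE; congr (_ * _).
rewrite mxE (eq_bigr (fun=> 1)) => [|i _]; last by rewrite !mxE chi_sq.
by rewrite sumr_const card_ord.
Qed.

(** Fourier inversion: [lambda] is the transform of the indicator of the even codewords of weight
    4. *)
Lemma sum_lambda_chi x : x \in Ce ->
  \sum_u lambda H R u * chi u x = #|{: word}|%:R * (wt x == 4%N)%:R.
Proof.
move=> xCe; under eq_bigr => u _ do rewrite /lambda big_distrl /=.
rewrite exchange_big /=.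
under eq_bigr => s _ do [under eq_bigr => u _ do rewrite -chiDr; rewrite sum_chi addw_eq0].
rewrite -big_distrr /=; congr (_ * _).
have [x4 | x_not4] := boolP (wt x == 4%N).
  rewrite (bigD1 x) ?xCe //= eqxx big1 ?addr0 // => s /andP[_ /negPf->] //.
by rewrite big1 // => s /andP[_ s4]; case: eqP => // sx; rewrite -sx s4 in x_not4.
Qed.

(** The transform of [z] extended by zero outside $\mathcal{C}_e$. As [u] runs over the whole space,
    characters of $\mathcal{C}_e$ may repeat; the factor [#|{: word}|] below accounts for this. *)
Definition fourier z u : R := \sum_i z i 0 * chi u (v i).

Lemma fourier_sq z u :
  fourier z u ^+ 2 = \sum_i \sum_j z i 0 * z j 0 * chi u (v i + v j).
Proof.
rewrite expr2 /fourier big_distrlr /=; apply: eq_bigr => i _; apply: eq_bigr => j _.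
by rewrite chiDr mulrACA.
Qed.

(** Common expansion for the two identities to come: weight 1 gives Parseval, weight [lambda] gives
    the quadratic form. *)
Lemma sum_weighted_fourier (f : word -> R) z :
  \sum_u f u * fourier z u ^+ 2 =
  \sum_i \sum_j (z i 0 * z j 0) * \sum_u f u * chi u (v i + v j).
Proof.
under eq_bigr => u _ do rewrite fourier_sq big_distrr /=.
rewrite exchange_big /=; apply: eq_bigr => i _.
under eq_bigr => u _ do rewrite big_distrr /=.
rewrite exchange_big /=; apply: eq_bigr => j _.
by rewrite big_distrr /=; apply: eq_bigr => u _; rewrite mulrCA.
Qed.

Lemma sum_fourier_sq z : cut_vector z ->
  \sum_u fourier z u ^+ 2 = #|{: word}|%:R * m%:R.
Proof.
move=> zc; under eq_bigr => u _ do rewrite -[_ ^+ 2]mul1r.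
rewrite (sum_weighted_fourier (fun=> 1)).
transitivity (\sum_(i < m) #|{: word}|%:R : R); last first.
  by rewrite sumr_const card_ord mulr_natr.
apply: eq_bigr => i _.
have sumE j : \sum_u 1 * chi u (v i + v j) = #|{: word}|%:R * (i == j)%:R.
  rewrite -(inj_eq v_inj) -addw_eq0 -sum_chi.
  by apply: eq_bigr => u _; rewrite mul1r.
rewrite (bigD1 i) //= sumE [X in _ + X]big1 => [|j ji]; last rewrite sumE.
  by rewrite eqxx addr0 cut_vector_sq // mul1r mulr1.
by rewrite eq_sym (negPf ji) !mulr0.
Qed.

Lemma sum_lambda_fourier_sq z :
  \sum_u lambda H R u * fourier z u ^+ 2 = #|{: word}|%:R * qform A z.
Proof.
rewrite sum_weighted_fourier qformE big_distrr /=; apply: eq_bigr => i _.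
rewrite big_distrr /=; apply: eq_bigr => j _.
by rewrite sum_lambda_chi ?evenD ?v_even // mxE dHE; ring.
Qed.

(** By the two preceding identities, [qform A z] divided by [m] is an average of the eigenvalues
    with the nonnegative weights [fourier z u ^+ 2]. *)
Lemma qform_lower_bound z : cut_vector z -> lambda_min H R * m%:R <= qform A z.
Proof.
move=> zc; have K_gt0 : 0 < #|{: word}|%:R :> R.
  by rewrite ltr0n; apply/card_gt0P; exists 0.
rewrite -(ler_pM2l K_gt0) -sum_lambda_fourier_sq mulrCA -(sum_fourier_sq z) //.
rewrite big_distrr /=; apply: ler_sum => u _.
by rewrite ler_wpM2r ?sqr_ge0 // bigmin_le.
Qed.

(** The product of two entries of [z] is 1 on equally coloured codewords and -1 otherwise, that is,
    twice the indicator of equality minus 1. The subtracted sum does not depend on [z]. *)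
Lemma card_mono_pairs z (a : word -> 'rV['F_2]_2) p q : p != q ->
  cut_vector z ->
  (forall i, (z i 0 = 1 -> a (v i) = p) /\ (z i 0 = -1 -> a (v i) = q)) ->
  qform A z = 2 * #|@mono_pairs n H a|%:R - \sum_i \sum_j A i j.
Proof.
move=> pq zc az.
have -> : #|@mono_pairs n H a|%:R = \sum_i \sum_j A i j * (a (v i) == a (v j))%:R.
  rewrite -sum1_card natr_sum.
  pose F c d : R := (dH c d == 4%N)%:R * (a c == a d)%:R.
  transitivity (\sum_i \sum_j F (v i) (v j)).
    under [RHS]eq_bigr => i _ do rewrite (sum_v _ (F (v i))).
    rewrite (sum_v _ (fun c => \sum_(d in Ce) F c d)) pair_big /=.
    rewrite big_mkcond [RHS]big_mkcond /=; apply: eq_bigr => -[c d] _ /=.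
    rewrite [_ \in mono_pairs a]inE /F /=.
    case: (c \in Ce) => //; case: (d \in Ce) => //=.
    by case: (dH c d == 4%N); case: (a c == a d); rewrite ?mulr1 ?mulr0.
  by apply: eq_bigr => i _; apply: eq_bigr => j _; rewrite mxE.
rewrite qformE big_distrr /= -sumrB; apply: eq_bigr => i _.
rewrite big_distrr /= -sumrB; apply: eq_bigr => j _.
suff -> : z i 0 * z j 0 = 2 * (a (v i) == a (v j))%:R - 1 by ring.
have qp : (q == p) = false by rewrite eq_sym (negPf pq).
have [ip iq] := az i; have [jp jq] := az j.
case: (zc i) => zi; [rewrite (ip zi) | rewrite (iq zi)];
  case: (zc j) => zj; [rewrite (jp zj) | rewrite (jq zj) | rewrite (jp zj) | rewrite (jq zj)];
  rewrite zi zj ?eqxx ?qp ?(negPf pq) /=; ring.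
Qed.

End Spectrum.

(** * From minimizing eigenvectors to optimal assignments *)

Theorem theorem4 (R : realFieldType) (n : nat) (n_ge2 : (2 <= n)%N)
    (H : 'M['F_2]_(n, 2 ^ n - 1)) (HH : hamming_matrix H)
    (v : 'I_#|even_code H| -> 'rV['F_2]_(2 ^ n - 1))
    (v_inj : injective v)
    (v_onto : [set v i | i : 'I_#|even_code H|] = even_code H) :
  (forall u : 'rV['F_2]_(2 ^ n - 1),
     eigenvector (G4_adj R v) (lambda H R u) (evec R v u)) /\
  (forall u : 'rV['F_2]_(2 ^ n - 1), lambda H R u = lambda_min H R ->
   forall z : 'cV[R]_#|even_code H|, z = evec R v u \/ z = - evec R v u ->
     cut_vector z /\
     (forall z' : 'cV[R]_#|even_code H|, cut_vector z' ->
        qform (G4_adj R v) z <= qform (G4_adj R v) z') /\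
     (forall (p : 'rV['F_2]_2) (P P' : {set 'rV['F_2]_2}),
        P = [set p; compl p] -> [set P; P'] = [set Pe; Po] ->
        forall a : 'rV['F_2]_(2 ^ n - 1) -> 'rV['F_2]_2,
          (forall i, (z i 0 = 1 -> a (v i) = p) /\
                     (z i 0 = -1 -> a (v i) = compl p)) ->
          optimal_even H P P' a)).
Proof.
split=> [u | u u_min z zE]; first exact: evec_eigenvector.
have zc : cut_vector z.
  by case: zE => ->; [|apply: cut_vectorN]; apply: evec_cut.
have z_min z' : cut_vector z' -> qform (G4_adj R v) z <= qform (G4_adj R v) z'.
  move=> z'c; have -> : qform (G4_adj R v) z = lambda_min H R * #|even_code H|%:R.
    by rewrite -u_min -(qform_evec v_inj v_onto); case: zE => ->; rewrite ?qformN.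
  exact: qform_lower_bound.
split=> //; split=> // p P P' PE PP' a az.
have p_neq : p != compl p by rewrite -dH_eq0 dH_compl.
have vP c : c \in even_code H -> exists i, c = v i.
  by rewrite -[in X in _ \in X]v_onto => /imsetP[i _ ->]; exists i.
apply: (optimal_of_mono_min HH _ _ _ PP') => [c /vP[i ->] | a' a'P].
  have [a1 aN1] := az i.
  by rewrite PE !inE; case: (zc i) => [/a1->|/aN1->]; rewrite eqxx ?orbT.
(* Every competing assignment [a'] into [P] arises from a cut vector, so the minimality of [z]
   applies to it. *)
pose z' : 'cV[R]_#|even_code H| := \col_i (if a' (v i) == p then 1 else -1).
have z'c : cut_vector z' by move=> i; rewrite mxE; case: ifP; [left | right].
have neq1N1 : 1 != -1 :> R by rewrite -subr_eq0 opprK -mulr2n pnatr_eq0.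
have a'z' i : (z' i 0 = 1 -> a' (v i) = p) /\ (z' i 0 = -1 -> a' (v i) = compl p).
  rewrite mxE; case: eqP => [-> | ap]; split=> // /eqP.
  - by rewrite (negPf neq1N1).
  - by rewrite eq_sym (negPf neq1N1).
  move=> _; have := a'P (v i); rewrite (v_even v_onto) PE !inE => /(_ isT).
  by case/orP=> /eqP.
have := z_min z' z'c.
rewrite (card_mono_pairs v_inj v_onto _ _ _ _ p_neq zc az).
rewrite (card_mono_pairs v_inj v_onto _ _ _ _ p_neq z'c a'z').
(* Both forms are the same increasing affine function of the number of uncut pairs. *)
by rewrite lerD2r ler_pM2l ?ltr0n // ler_nat.
Qed.
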